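(* Let $f:\mathbb{R}^n\to\mathbb{R}$ satisfy the standing assumption in the context. Consider the SLO algorithm with the truncated gradient descent subroutine $$x_{k+1}^\tau=\mathcal{A}_{TG}\big(f,x_k^\tau,L_1^\tau,d\big),\qquad L_1^\tau=\mathcal{L}_1(B(x_0^\tau,D)),$$ with $d\ge\sqrt\epsilon$ and $D\ge\frac{\sqrt\epsilon}{2}+2d$. Put $\Delta_f:=f(x_0^1)-f^*$ and $R_T:=\frac{4\Delta_f}{\sqrt\epsilon}+D$. Then the algorithm takes at most $T=\left\lceil\frac{4(f(x_0^1)-f^* )}{\sqrt\epsilon D}+1\right\rceil$ epochs to output a point $x_k^\tau$ with $\|\nabla f(x_k^\tau)\|^2\le\epsilon$. Moreover, the total computational complexity (number of gradient evaluations) is bounded by $$\sum_{\tau=1}^TK_\tau\le\mathcal{O}\Big(\frac{\Delta_f}{\epsilon}\cdot\mathcal{L}_1\big(B(x_0^1,R_T)\big)\Big),$$ where $\mathcal{O}(\cdot)$ hides an absolute constant.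
   Context: Norms are Euclidean and $B(x,r)=\{y:\|y-x\|\le r\}$. Standing assumption: $f$ is continuously differentiable, $f^*:=\inf_xf(x)>-\infty$, and $\nabla f$ is locally but not globally Lipschitz. For each compact $C\subsetneq\mathbb{R}^n$, $\mathcal{L}_1(C)\ge1$ denotes the Lipschitz constant of $\nabla f$ on $C$, i.e. $\|\nabla f(x)-\nabla f(y)\|\le\mathcal{L}_1(C)\|x-y\|$ for $x,y\in C$; it is monotone in $C$. The values of $\mathcal{L}_1$ on the balls used by the algorithm are available to it. Truncated gradient descent subroutine: for $L,d>0$, $\mathcal{A}_{TG}(f,x,L,d)=x-\frac1L\nabla f(x)$ if $\|\nabla f(x)\|\le Ld$, and $\mathcal{A}_{TG}(f,x,L,d)=x-d\frac{\nabla f(x)}{\|\nabla f(x)\|}$ otherwise. SLO algorithm. Inputs: $x_0^1$, $\epsilon>0$, $D>0$, $d\ge0$. For epochs $\tau=1,2,\dots$: compute $L_1^\tau$. For $k=0,1,2,\dots$: (a) if $\|\nabla f(x_k^\tau)\|<\sqrt\epsilon$, terminate and return $x_k^\tau$; (b) compute $x_{k+1}^\tau$ by the subroutine; (c) if $\|x_{k+1}^\tau-x_0^\tau\|\in[D-d,D]$, set $x_0^{\tau+1}=x_{k+1}^\tau$, end epoch $\tau$ and start epoch $\tau+1$. $K_\tau$ is the index of the last iterate of epoch $\tau$; each execution of the subroutine costs one gradient evaluation. *)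

(* Defs.v *)
From HB Require Import structures.
From mathcomp Require Import all_boot all_order all_algebra.
From mathcomp Require Import all_classical all_reals all_analysis.

Set Implicit Arguments.
Unset Strict Implicit.
Unset Printing Implicit Defensive.

Import Order.TTheory GRing.Theory Num.Theory.
Import numFieldNormedType.Exports.

Local Open Scope classical_set_scope.
Local Open Scope ring_scope.

(* The norm `|v| that the library puts on row vectors is the sup norm; the
   topology of 'rV[R]_n it induces is the usual one, but every quantitative
   notion below uses [enorm], including the balls and Lipschitz constants. *)
Definition enorm (R : realType) (n : nat) (v : 'rV[R]_n) : R :=
  Num.sqrt (\sum_(i < n) v ord0 i ^+ 2).

Definition eball (R : realType) (n : nat) (x : 'rV[R]_n) (r : R) :
    set 'rV[R]_n :=
  [set y | enorm (y - x) <= r].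

Definition grad (R : realType) (n : nat) (f : 'rV[R]_n -> R)
    (x : 'rV[R]_n) : 'rV[R]_n :=
  \row_(i < n) 'D_(delta_mx ord0 i) f x.

Definition continuously_differentiable (R : realType) (n : nat)
    (f : 'rV[R]_n -> R) : Prop :=
  (forall x, differentiable f x) /\ continuous (grad f).

Definition elipschitz_on (R : realType) (n : nat) (A : set 'rV[R]_n) (L : R)
    (g : 'rV[R]_n -> 'rV[R]_n) : Prop :=
  forall x y, A x -> A y -> enorm (g x - g y) <= L * enorm (x - y).

Definition locally_elipschitz (R : realType) (n : nat)
    (g : 'rV[R]_n -> 'rV[R]_n) : Prop :=
  forall x, exists r L : R, 0 < r /\ elipschitz_on (eball x r) L g.

Definition globally_elipschitz (R : realType) (n : nat)
    (g : 'rV[R]_n -> 'rV[R]_n) : Prop :=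
  exists L : R, elipschitz_on setT L g.

Definition standing_assumption (R : realType) (n : nat)
    (f : 'rV[R]_n -> R) : Prop :=
  [/\ continuously_differentiable f,
      has_lbound (range f),
      locally_elipschitz (grad f)
    & ~ globally_elipschitz (grad f)].

(* The values of [L1] on sets that are not compact and proper are irrelevant. *)
Definition lipschitz_constants (R : realType) (n : nat) (f : 'rV[R]_n -> R)
    (L1 : set 'rV[R]_n -> R) : Prop :=
  (forall C, compact C -> C `<` setT ->
     1 <= L1 C /\ elipschitz_on C (L1 C) (grad f)) /\
  (forall C C', compact C -> compact C' -> C' `<` setT -> C `<=` C' ->
     L1 C <= L1 C').

Definition truncated_gradient (R : realType) (n : nat) (f : 'rV[R]_n -> R)
    (x : 'rV[R]_n) (L d : R) : 'rV[R]_n :=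
  if enorm (grad f x) <= L * d then x - L^-1 *: grad f x
  else x - (d / enorm (grad f x)) *: grad f x.

(* The configuration (tau, k, x_0^tau, x_k^tau). *)
Record slo_state (R : realType) (n : nat) := SLOState {
  slo_epoch : nat;
  slo_index : nat;
  slo_start : 'rV[R]_n;
  slo_point : 'rV[R]_n
}.

Definition slo_init (R : realType) (n : nat) (x : 'rV[R]_n) : slo_state R n :=
  SLOState 1 0 x x.

(* One transition; [None] means that the algorithm returns the current point.
   The end-of-epoch test is applied to an iterate as soon as it has been
   computed (hence only for k > 0), before its gradient test: the latter is
   then made on the same point as iterate 0 of the next epoch.  Only the last
   branch executes the subroutine. *)
Definition slo_step (R : realType) (n : nat) (f : 'rV[R]_n -> R)
    (L1 : set 'rV[R]_n -> R) (eps D d : R) (s : slo_state R n) :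
    option (slo_state R n) :=
  let: SLOState tau k x0 x := s in
  if (0 < k)%N && (D - d <= enorm (x - x0) <= D)
  then Some (SLOState tau.+1 0 x x)
  else if enorm (grad f x) < Num.sqrt eps then None
  else Some (SLOState tau k.+1 x0
               (truncated_gradient f x (L1 (eball x0 D)) d)).

(* [slo_run f L1 eps D d s tr out]: started in [s], the algorithm goes through
   the successive states [tr] and then returns, its final state being [out]. *)
Inductive slo_run (R : realType) (n : nat) (f : 'rV[R]_n -> R)
    (L1 : set 'rV[R]_n -> R) (eps D d : R) :
    slo_state R n -> seq (slo_state R n) -> slo_state R n -> Prop :=
| slo_return s :
    slo_step f L1 eps D d s = None ->
    slo_run f L1 eps D d s [:: s] s
| slo_continue s s' tr out :
    slo_step f L1 eps D d s = Some s' ->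
    slo_run f L1 eps D d s' tr out ->
    slo_run f L1 eps D d s (s :: tr) out.

(* K_tau. Indices increase within an epoch, so the last one is the largest;
   it is 0 for an epoch that is not reached. *)
Definition last_index (R : realType) (n : nat) (tr : seq (slo_state R n))
    (tau : nat) : nat :=
  \max_(s <- tr | slo_epoch s == tau) slo_index s.

(* Main.v *)
Require Import Defs.
From HB Require Import structures.
From mathcomp Require Import all_boot all_order all_algebra.
From mathcomp Require Import all_classical all_reals all_analysis.
From mathcomp Require Import ring lra.
Import Order.TTheory GRing.Theory Num.Theory.
Import numFieldNormedType.Exports.
Local Open Scope classical_set_scope.
Local Open Scope ring_scope.

(** The argument is an energy count.  On the ball of radius [D] around the
    start of an epoch, [grad f] is [L]-Lipschitz, where [L] is the constant of
    the epoch, and both branches of the subroutine move by [- a grad f x] with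
    [a <= 1 / L].  The descent lemma then gives a decrease of [f] of at least
    [a |grad f x| ^ 2 / 2] ([gradient_step_decrease]).  While
    [|grad f x| >= sigma], with [sigma = sqrt eps], this has two readings
    ([truncated_gradient_decrease]): [f] drops by at least [sigma / 2] per unit
    of length travelled, and by at least [eps / (2 L)] per step.

    The first reading controls the geometry.  An epoch that ends has moved by
    at least [D - d >= D / 2], hence has cost [sigma D / 4], which bounds the
    number of epochs; and the whole path has length at most [2 Delta / sigma],
    so that every ball used by the algorithm lies in the ball of radius [RT]
    around the initial point, whose constant [Lmax] dominates all the others.
    A step has length at most [d], so it cannot jump over the shell of radii
    [D - d] and [D], and the iterates never leave the ball of their epoch.
    These facts form an invariant of the transitions ([slo_step_inv]).

    The second reading then bounds the number of executions of the subroutine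
    by [2 Lmax Delta / eps], whence termination ([slo_run_exists]) and, since
    the last index of an epoch counts the executions made in it, the complexity
    bound with constant 2 ([sum_last_index_le]). *)

Set Implicit Arguments.
Unset Strict Implicit.
Unset Printing Implicit Defensive.

(** * Euclidean geometry of row vectors *)

Definition dotv (R : realType) (n : nat) (u v : 'rV[R]_n) : R :=
  \sum_(i < n) u ord0 i * v ord0 i.

Section EuclideanNorm.
Context {R : realType} {n : nat}.
Implicit Types (u v x y : 'rV[R]_n) (a r : R).

Lemma dotvC u v : dotv u v = dotv v u.
Proof. by apply: eq_bigr => i _; rewrite mulrC. Qed.

Lemma dotvDr u v w : dotv u (v + w) = dotv u v + dotv u w.
Proof. by rewrite -big_split; apply: eq_bigr => i _; rewrite mxE mulrDr. Qed.

Lemma dotvZr a u v : dotv u (a *: v) = a * dotv u v.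
Proof. by rewrite big_distrr; apply: eq_bigr => i _; rewrite mxE mulrCA. Qed.

Lemma dotvDl u v w : dotv (v + w) u = dotv v u + dotv w u.
Proof. by rewrite dotvC dotvDr !(dotvC u). Qed.

Lemma dotvZl a u v : dotv (a *: v) u = a * dotv v u.
Proof. by rewrite dotvC dotvZr dotvC. Qed.

Lemma enorm_ge0 v : 0 <= enorm v.
Proof. exact: sqrtr_ge0. Qed.

Lemma enorm_sqr v : enorm v ^+ 2 = dotv v v.
Proof.
rewrite sqr_sqrtr; last by apply: sumr_ge0 => i _; exact: sqr_ge0.
by apply: eq_bigr => i _; rewrite expr2.
Qed.

Lemma enorm0 : enorm (0 : 'rV[R]_n) = 0.
Proof.
by rewrite /enorm big1 ?sqrtr0// => i _; rewrite mxE expr0n.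
Qed.

Lemma enormZ a v : enorm (a *: v) = `|a| * enorm v.
Proof.
apply/eqP; rewrite -(@eqrXn2 _ 2) ?mulr_ge0 ?enorm_ge0//.
by rewrite exprMn real_normK ?num_real// !enorm_sqr dotvZl dotvZr mulrA.
Qed.

Lemma enormN v : enorm (- v) = enorm v.
Proof. by rewrite -scaleN1r enormZ normrN1 mul1r. Qed.

Lemma coord_le_enorm v i : `|v ord0 i| <= enorm v.
Proof.
rewrite -sqrtr_sqr ler_wsqrtr// (bigD1 i)//= lerDl.
by apply: sumr_ge0 => j _; exact: sqr_ge0.
Qed.

Lemma enorm0_eq0 v : enorm v = 0 -> v = 0.
Proof.
move=> v0; apply/rowP => i; apply/eqP.
by rewrite mxE -normr_le0 -v0 coord_le_enorm.
Qed.

(** The square of [|v| u - |u| v] is [2 |u| |v| (|u| |v| - <u, v>)]. *)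
Lemma dotv_le_enorm u v : dotv u v <= enorm u * enorm v.
Proof.
have [/enorm0_eq0 ->|u0] := eqVneq (enorm u) 0.
  by rewrite enorm0 mul0r /dotv big1// => i _; rewrite mxE mul0r.
have [/enorm0_eq0 ->|v0] := eqVneq (enorm v) 0.
  by rewrite enorm0 mulr0 /dotv big1// => i _; rewrite mxE mulr0.
have uv0 : 0 < enorm u * enorm v by rewrite mulr_gt0// lt0r ?u0 ?v0 enorm_ge0.
have := sqr_ge0 (enorm (enorm v *: u + (- enorm u) *: v)).
rewrite enorm_sqr !(dotvDl, dotvDr, dotvZl, dotvZr) -!enorm_sqr (dotvC v u).
move: (dotv u v) => p; nra.
Qed.

Lemma ler_enormD u v : enorm (u + v) <= enorm u + enorm v.
Proof.
rewrite -(@ler_pXn2r _ 2) ?nnegrE ?addr_ge0 ?enorm_ge0//.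
rewrite sqrrD !enorm_sqr !(dotvDl, dotvDr) (dotvC v u).
have := dotv_le_enorm u v; lra.
Qed.

Lemma ler_enorm_distD y x z : enorm (x - z) <= enorm (x - y) + enorm (y - z).
Proof. by rewrite -[x - z](subrKA y) ler_enormD. Qed.

Lemma continuous_sqr_coordB x i :
  continuous (fun y : 'rV[R]_n => (y ord0 i - x ord0 i) ^+ 2).
Proof.
move=> y; apply: (@continuous_comp _ _ _
  (fun y : 'rV[R]_n => y ord0 i - x ord0 i) (fun t : R => t ^+ 2));
  last exact: exprn_continuous.
apply: (@continuousB R R _ (fun y : 'rV[R]_n => y ord0 i)
  (fun=> x ord0 i)); last exact: cst_continuous.
exact: coord_continuous.
Qed.

Lemma continuous_enormB x : continuous (fun y => enorm (y - x)).
Proof.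
move=> y.
apply: (@continuous_comp _ _ _
  (fun y : 'rV[R]_n => \sum_(i < n) (y - x) ord0 i ^+ 2) Num.sqrt);
  last exact: sqrt_continuous.
move: y; apply: continuous_big => [|i _ y]; first exact: add_continuous.
under eq_fun do rewrite !mxE.
exact: continuous_sqr_coordB.
Qed.

Lemma compact_eball x r : compact (eball x r).
Proof.
apply: bounded_closed_compact; last first.
  apply: (@preimage_closed _ _ (fun y => enorm (y - x)) [set t | t <= r]).
    by move=> y _; exact: continuous_enormB.
  exact: closed_le.
exists (r + enorm x); split; first exact: num_real.
move=> M rM y yx.
have yM : enorm y <= M.
  by have := ler_enormD (y - x) x; rewrite subrK; move: yx rM;
     rewrite /eball/=; lra.
rewrite /= [leLHS]/Num.norm/= mx_normrE.
apply: bigmax_le => [|[i j] _ /=]; first exact: le_trans (enorm_ge0 y) yM.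
by rewrite ord1 (le_trans (coord_le_enorm y j)).
Qed.

End EuclideanNorm.

Lemma eball_proper (R : realType) (n : nat) (x : 'rV[R]_n.+1) (r : R) :
  eball x r `<` setT.
Proof.
split=> // /(_ (x + const_mx (`|r| + 1)) I).
rewrite /eball/= (addrC x) addrK leNgt => /negP; apply.
apply: lt_le_trans (coord_le_enorm _ ord0).
by rewrite mxE (lt_le_trans _ (ler_norm _))// ltr_pwDr// ler_norm.
Qed.

(** * The descent lemma and one truncated step *)

Section Descent.
Context {R : realType} {n : nat}.
Implicit Types (f : 'rV[R]_n -> R) (x h : 'rV[R]_n) (a L t : R).

Lemma derive_dotv_grad f x h :
  differentiable f x -> 'D_h f x = dotv (grad f x) h.
Proof.
move=> fx; rewrite deriveE// {1}[h]row_sum_delta linear_sum/=.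
by apply: eq_bigr => i _; rewrite linearZ/= mxE deriveE// mulrC.
Qed.

Lemma is_derive_line f x h t : differentiable f (x + t *: h) ->
  is_derive t 1 (fun t => f (x + t *: h)) (dotv (grad f (x + t *: h)) h).
Proof.
move=> fx.
have E : (fun s : R => s^-1 *: (f (x + (s *: 1 + t) *: h) - f (x + t *: h))) =
         (fun s : R => s^-1 *: (f (s *: h + (x + t *: h)) - f (x + t *: h))).
  by apply/funext => s; rewrite scalerDl addrCA /GRing.scale/= mulr1.
apply: DeriveDef.
  by rewrite /derivable E; exact: diff_derivable.
by rewrite -derive_dotv_grad// /derive E.
Qed.

(** Along the segment, [t |-> f (x + t h) - t <grad f x, h> - L t^2 |h|^2 / 2]
    has derivative [<grad f (x + t h) - grad f x, h> - L t |h|^2], which the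
    Lipschitz bound and the Cauchy-Schwarz inequality make nonpositive. *)
Lemma descent f x h L :
  (forall y, differentiable f y) ->
  (forall t, 0 <= t <= 1 ->
     enorm (grad f (x + t *: h) - grad f x) <= L * enorm (t *: h)) ->
  f (x + h) <= f x + dotv (grad f x) h + L / 2 * enorm h ^+ 2.
Proof.
move=> df lip.
pose c := dotv (grad f x) h; pose e := L / 2 * enorm h ^+ 2.
pose phi t := f (x + t *: h) - (t * c + t ^+ 2 * e).
pose dphi t := dotv (grad f (x + t *: h)) h - (c + 2 * t * e).
have dphiP t : is_derive t 1 phi (dphi t).
  have Hf := is_derive_line (df (x + t *: h)).
  apply: is_derive_eq.
  by rewrite /dphi /GRing.scale/=; ring.
have cphi : {within `[0, 1], continuous phi}.
  apply: derivable_within_continuous => u _; exact: ex_derive.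
have [t] := MVT_segment ler01 (fun t _ => dphiP t) cphi.
rewrite in_itv/= => t01; rewrite /phi/dphi scale1r scale0r addr0 => E.
have t0 : 0 <= t by case/andP: t01.
have := dotv_le_enorm (grad f (x + t *: h) - grad f x) h.
rewrite -scaleN1r dotvDl dotvZl.
have := ler_wpM2r (enorm_ge0 h) (lip t t01).
rewrite enormZ (ger0_norm t0) scaleN1r.
move: E; rewrite /e -/c; lra.
Qed.

(** A gradient step of size [a <= 1 / L] realises at least half of its
    first-order decrease. *)
Lemma gradient_step_decrease f x a L :
  (forall y, differentiable f y) -> 0 <= a -> a * L <= 1 ->
  (forall t, 0 <= t <= 1 ->
     enorm (grad f (x - t *: (a *: grad f x)) - grad f x)
       <= L * enorm (t *: (a *: grad f x))) ->
  f (x - a *: grad f x) <= f x - a / 2 * enorm (grad f x) ^+ 2.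
Proof.
move=> df a0 aL lip.
have := @descent f x (- (a *: grad f x)) L df.
have -> : dotv (grad f x) (- (a *: grad f x)) = - a * enorm (grad f x) ^+ 2.
  by rewrite -scaleNr dotvZr enorm_sqr.
rewrite enormN enormZ (ger0_norm a0) exprMn => /(_ _)/le_trans; apply.
  by move=> t t01; rewrite scalerN enormN; exact: lip.
have := sqr_ge0 (enorm (grad f x)); move: (enorm _ ^+ 2) => G G0.
have : a * (a * L) * G <= a * 1 * G by rewrite ler_wpM2r ?ler_wpM2l.
lra.
Qed.

(** Both branches of the subroutine are gradient steps of some size at most
    [1 / L]; the last bound turns the decrease of such a step into a multiple
    of [s ^ 2 / L]. *)
Lemma truncated_gradientE f x L d s :
  1 <= L -> 0 < s -> s <= d -> s <= enorm (grad f x) ->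
  exists a : R,
    [/\ truncated_gradient f x L d = x - a *: grad f x,
        0 <= a, a * L <= 1, a * enorm (grad f x) <= d
      & s ^+ 2 <= a * enorm (grad f x) ^+ 2 * L].
Proof.
move=> L1 s0 sd sg.
have L0 : 0 < L by exact: lt_le_trans L1.
have g0 : 0 < enorm (grad f x) by exact: lt_le_trans sg.
rewrite /truncated_gradient; move: sg g0; set g := enorm _ => sg g0.
case: ifPn => [gL|]; last rewrite -ltNge => gL.
  exists L^-1; split=> //; first by rewrite invr_ge0 ltW.
  - by rewrite mulVf// gt_eqF.
  - by rewrite mulrC ler_pdivrMr// mulrC.
  - by rewrite mulrAC mulVf ?gt_eqF// mul1r; nra.
exists (d / g); split=> //.
- by rewrite divr_ge0 ?(ltW g0)//; lra.
- by rewrite mulrAC ler_pdivrMr// mul1r; lra.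
- by rewrite divfK// gt_eqF.
- have -> : d / g * g ^+ 2 = d * g by rewrite expr2 mulrA divfK// gt_eqF.
  have : s ^+ 2 <= d * g by nra.
  nra.
Qed.

(** Truncation at [d >= s] keeps the second bound: a truncated step decreases
    [f] by [d |grad f| / 2 >= s ^ 2 / 2]. The first one says that [f] pays at
    least [s / 2] per unit of length travelled. *)
Lemma truncated_gradient_decrease f x0 x L d D s :
  (forall y, differentiable f y) -> elipschitz_on (eball x0 D) L (grad f) ->
  1 <= L -> 0 < s -> s <= d -> s <= enorm (grad f x) ->
  enorm (x - x0) <= D - d ->
  let y := truncated_gradient f x L d in
  [/\ enorm (y - x0) <= D,
      s / 2 * enorm (y - x) <= f x - f y
    & s ^+ 2 <= 2 * L * (f x - f y)].
Proof.
move=> df lip L1 s0 sd sg xD /=.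
have [a [-> a0 aL agd sL]] := truncated_gradientE L1 s0 sd sg.
move: sg agd sL; set g := enorm (grad f x) => sg agd sL.
(* The whole segment from [x] to the next iterate lies in the ball. *)
have stay t : 0 <= t <= 1 -> enorm (x - t *: (a *: grad f x) - x0) <= D.
  move=> /andP[t0 t1]; rewrite addrAC.
  apply: le_trans (ler_enormD _ _) _.
  rewrite enormN !enormZ (ger0_norm t0) (ger0_norm a0) -/g.
  have : 0 <= a * g by nra.
  nra.
have dec : f (x - a *: grad f x) <= f x - a / 2 * g ^+ 2.
  apply: (gradient_step_decrease df a0 aL) => t t01.
  rewrite -(enormN (t *: _)) -[X in _ * enorm X](addKr x) [- x + _]addrC.
  apply: lip; first exact: stay.
  by rewrite /eball/=; move: (stay 0); rewrite scale0r subr0 lexx ler01; exact.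
split; first by move: (stay 1); rewrite scale1r ler01 lexx; exact.
- rewrite addrAC subrr add0r enormN enormZ (ger0_norm a0) -/g.
  have : a * g * s <= a * g * g by rewrite ler_wpM2l//; nra.
  lra.
- have : L * (a / 2 * g ^+ 2) <= L * (f x - f (x - a *: grad f x)).
    by rewrite ler_wpM2l//; lra.
  lra.
Qed.

End Descent.

(** * Runs with a potential *)

Section Runs.
Context {R : realType} {n : nat} (f : 'rV[R]_n -> R)
  (L1 : set 'rV[R]_n -> R) (eps D d : R).
Implicit Types (s out : slo_state R n) (tr : seq (slo_state R n)).
Local Notation step := (slo_step f L1 eps D d).
Local Notation run := (slo_run f L1 eps D d).

Lemma slo_step_counters s s' : step s = Some s' ->
  [/\ (0 < slo_index s)%N, slo_epoch s' = (slo_epoch s).+1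
    & slo_index s' = 0%N] \/
  (slo_epoch s' = slo_epoch s /\ slo_index s' = (slo_index s).+1).
Proof.
case: s => tau k x0 x /=; case: ifPn => [/andP[k0 _] [<-]|_]; first by left.
by case: ifPn => // _ [<-]; right.
Qed.

Lemma last_index_cons s tr tau :
  last_index (s :: tr) tau =
  if slo_epoch s == tau then maxn (slo_index s) (last_index tr tau)
  else last_index tr tau.
Proof. by rewrite /last_index big_cons. Qed.

Lemma last_index_start s tr out :
  run s tr out -> (slo_index s <= last_index tr (slo_epoch s))%N.
Proof.
by case=> [{}s _|{}s s' {}tr {}out _ _]; rewrite last_index_cons eqxx leq_maxl.
Qed.

Lemma last_index_past s tr out tau :
  run s tr out -> (tau < slo_epoch s)%N -> last_index tr tau = 0%N.
Proof.
elim=> [{}s _|{}s s' {}tr {}out /slo_step_counters ss' _ IH] lt_tau;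
  rewrite last_index_cons gtn_eqF//; first by rewrite /last_index big_nil.
by apply: IH; case: ss' => [[_ -> _]|[-> _]] //; exact: ltnW.
Qed.

(** A transition executes the subroutine when it stays in the same epoch; each
    execution must consume one unit of [w], which therefore bounds the number
    of executions still to come. *)
Variables (P : slo_state R n -> Prop) (w : slo_state R n -> R).
Hypothesis w_ge0 : forall s, P s -> 0 <= w s.
Hypothesis step_w : forall s s', P s -> step s = Some s' ->
  P s' /\ w s' + (slo_epoch s' == slo_epoch s)%:R <= w s.

(** A change of epoch does not consume [w], but cannot happen twice in a row
    as it needs a positive index; hence [2 w + (0 < k)] drops by at least one
    at every transition. *)
Lemma slo_run_exists s : P s ->
  exists tr out, [/\ run s tr out, P out & step out = None].
Proof.
move=> Ps; have [N] : exists N, 2 * w s + (0 < slo_index s)%N%:R < N%:R.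
  have b_ge0 : 0 <= 2 * w s + (0 < slo_index s)%N%:R.
    by rewrite addr_ge0// mulr_ge0// w_ge0.
  by exists (Num.bound (2 * w s + (0 < slo_index s)%N%:R)); exact: archi_boundP.
elim: N s Ps => [|N IH] s Ps lt_N.
  by have := w_ge0 Ps; have := ler0n R (0 < slo_index s)%N; lra.
case E : (step s) => [s'|]; last by exists [:: s], s; split=> //; constructor.
have [Ps' w'] := step_w Ps E.
have [|tr [out [r Po oN]]] := IH s' Ps'; last first.
  by exists (s :: tr), out; split=> //; exact: slo_continue r.
move: lt_N w'; rewrite -natr1.
case: (slo_step_counters E) => [[-> -> ->]|[-> ->]].
  by rewrite (gtn_eqF (ltnSn _))/=; lra.
by rewrite eqxx/=; have := ler0n R (0 < slo_index s)%N; lra.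
Qed.

(** Within an epoch the last index grows by one per execution, and the next
    epoch counts again from 0: the sum over the current and later epochs is the
    current index plus the number of executions still to come. *)
Lemma sum_last_index_le T s tr out : run s tr out -> P s ->
  (\sum_(slo_epoch s <= tau < T) last_index tr tau)%:R <= (slo_index s)%:R + w s.
Proof.
elim=> [{}s _|{}s s' {}tr {}out E r IH] Ps.
  have [le_T|lt_T] := leqP T (slo_epoch s).
    by rewrite big_geq// addr_ge0// w_ge0.
  rewrite big_ltn// big_nat big1 => [|tau /andP[lt_tau _]].
    by rewrite addn0 last_index_cons eqxx /last_index big_nil maxn0 lerDl w_ge0.
  by rewrite last_index_cons ltn_eqF// /last_index big_nil.
have [Ps' w'] := step_w Ps E; have {}IH := IH Ps'.
have [le_T|lt_T] := leqP T (slo_epoch s).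
  by rewrite big_geq// addr_ge0// w_ge0.
(* The head of the trace only contributes to the term of its own epoch. *)
have cons_later tau : (slo_epoch s < tau < T)%N ->
    last_index (s :: tr) tau = last_index tr tau.
  by move=> /andP[lt_tau _]; rewrite last_index_cons ltn_eqF.
rewrite big_ltn// (eq_big_nat _ _ cons_later) last_index_cons eqxx.
move: w' IH (last_index_start r) (last_index_past (tau := slo_epoch s) r).
case: (slo_step_counters E) => [[_ -> ->]|[-> ->]].
  rewrite (gtn_eqF (ltnSn _)) addr0 add0r => w' IH _ /(_ (ltnSn _)) ->.
  by rewrite maxn0 natrD lerD2l; exact: le_trans w'.
rewrite eqxx/= => w' IH /ltnW/maxn_idPr-> _.
by move: IH; rewrite (big_ltn lt_T) -natr1; lra.
Qed.

End Runs.

(** * The invariant of the algorithm *)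

(** A gradient on a space of dimension 0 is globally Lipschitz, so the standing
    assumption leaves room outside every ball. *)
Lemma standing_eball_proper (R : realType) (n : nat) (f : 'rV[R]_n -> R)
    (x : 'rV[R]_n) (r : R) :
  standing_assumption f -> eball x r `<` setT.
Proof.
case: n f x => [|n] f x [_ _ _ nlip]; last exact: eball_proper.
by case: nlip; exists 0 => y z _ _; rewrite (thinmx0 (_ - _)) enorm0 mul0r.
Qed.

Section Invariant.
Context {R : realType} {n : nat} (f : 'rV[R]_n -> R)
  (L1 : set 'rV[R]_n -> R) (x01 : 'rV[R]_n) (eps D d : R).
Hypothesis fP : standing_assumption f.
Hypothesis L1P : lipschitz_constants f L1.
Hypothesis eps_gt0 : 0 < eps.
Hypothesis sd : Num.sqrt eps <= d.
Hypothesis sdD : Num.sqrt eps / 2 + 2 * d <= D.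
Local Notation sigma := (Num.sqrt eps).
Local Notation fmin := (inf (range f)).
Local Notation RT := (4 * (f x01 - fmin) / sigma + D).

(** [f] pays [sigma / 2] per unit of length, both between the start of the
    algorithm and that of the epoch, and within the epoch; an epoch that ends
    has travelled at least [D - d >= D / 2] and so has cost [sigma D / 4]. *)
Definition slo_inv (s : slo_state R n) : Prop :=
  let: SLOState tau k x0 x := s in
  [/\ k = 0%N -> x = x0,
      enorm (x - x0) <= D,
      sigma / 2 * enorm (x0 - x01) <= f x01 - f x0,
      sigma / 2 * enorm (x - x0) <= f x0 - f x
    & tau%:R * (sigma * D / 4) <= f x01 - f x0 + sigma * D / 4].

(** The decrease of [f] still available, divided by the cost [eps / (2 L)] of a
    step for the largest constant [L] that can occur. *)
Definition remaining_work (s : slo_state R n) : R :=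
  2 * L1 (eball x01 RT) / eps * (f (slo_point s) - fmin).

Let sigma_gt0 : 0 < sigma. Proof. by rewrite sqrtr_gt0. Qed.
Let fmin_le x : fmin <= f x.
Proof. by case: fP => _ lb _ _; apply: ge_inf lb _ _; exists x. Qed.
Let df x : differentiable f x. Proof. by case: fP => -[]. Qed.

Lemma L1_eball_ge1 x r : 1 <= L1 (eball x r).
Proof.
by case: L1P => /(_ _ (@compact_eball _ _ x r) (standing_eball_proper x r fP)) [].
Qed.

Lemma lipschitz_eball x r : elipschitz_on (eball x r) (L1 (eball x r)) (grad f).
Proof.
by case: L1P => /(_ _ (@compact_eball _ _ x r) (standing_eball_proper x r fP)) [].
Qed.

Lemma remaining_work_ge0 s : 0 <= remaining_work s.
Proof.
rewrite mulr_ge0 ?subr_ge0 ?fmin_le// divr_ge0 ?(ltW eps_gt0)// mulr_ge0//.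
exact: le_trans (L1_eball_ge1 _ _).
Qed.

Lemma slo_inv_init : slo_inv (slo_init x01).
Proof.
have x0 : enorm (x01 - x01) = 0 by rewrite subrr enorm0.
split; rewrite ?x0 ?mulr0 ?mul1r ?lerDr ?subrr //.
have := sigma_gt0; have := sd; have := sdD; lra.
Qed.

(** Starts of epochs stay within [2 (f x01 - fmin) / sigma] of the starting
    point of the algorithm. *)
Lemma slo_inv_L1_le tau k x0 x : slo_inv (SLOState tau k x0 x) ->
  L1 (eball x0 D) <= L1 (eball x01 RT).
Proof.
case=> _ _ x0_x01 _ _.
case: L1P => _; apply; try exact: compact_eball.
  exact: standing_eball_proper fP.
move=> y; rewrite /eball/= => yx0.
apply: le_trans (ler_enorm_distD x0 _ _) _; rewrite addrC lerD//.
rewrite ler_pdivlMr//.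
have := fmin_le x0; have := fmin_le x01; lra.
Qed.

Lemma slo_step_inv s s' : slo_inv s -> slo_step f L1 eps D d s = Some s' ->
  slo_inv s' /\
  remaining_work s' + (slo_epoch s' == slo_epoch s)%:R <= remaining_work s.
Proof.
case: s => tau k x0 x Is; have L1le := slo_inv_L1_le Is.
move: Is => -[k0 xD x0_x01 x_x0 tauP] /=.
have s0 := sigma_gt0; have half_ge0 : 0 <= sigma / 2 by lra.
have s_le := sd; have D_ge := sdD.
case: ifPn => [/andP[k_gt0 /andP[Dd _]] [<-]|Nend].
  rewrite /= (gtn_eqF (ltnSn _)) addr0; split=> //.
  have xx0 : enorm (x - x) = 0 by rewrite subrr enorm0.
  split=> //; rewrite ?xx0; try lra.
  - have := ler_wpM2l half_ge0 (ler_enorm_distD x0 x x01); lra.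
  - rewrite -natr1.
    have : sigma / 2 * (D / 2) <= sigma / 2 * enorm (x - x0).
      rewrite ler_wpM2l//; lra.
    lra.
case: (ltP (enorm (grad f x)) sigma) => // sg [<-]; rewrite /= eqxx.
(* The shell test has failed or, at index 0, the point is the centre. *)
have xDd : enorm (x - x0) <= D - d.
  case: k k0 Nend => [k0 _|k _]; first by rewrite k0// subrr enorm0; lra.
  by rewrite xD andbT -ltNge => /ltW.
have := truncated_gradient_decrease df (@lipschitz_eball x0 D)
  (L1_eball_ge1 x0 D) s0 sd sg xDd.
move: L1le (L1_eball_ge1 x0 D); set L := L1 _; set Lmax := L1 _.
set y := truncated_gradient _ _ _ _ => LLmax L_ge1 [yD pay cost].
split.
  split=> //.
  have := ler_wpM2l half_ge0 (ler_enorm_distD x y x0); lra.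
rewrite /remaining_work/= -/Lmax -lerBrDl -mulrBr.
rewrite mulrAC ler_pdivlMr// mul1r.
move: cost; rewrite sqr_sqrtr ?(ltW eps_gt0)// => cost.
have : 0 <= f x - f y.
  by apply: le_trans pay; rewrite mulr_ge0 ?enorm_ge0.
nra.
Qed.

End Invariant.

Theorem theorem2p11 :
  exists c : nat,
  forall (R : realType) (n : nat) (f : 'rV[R]_n -> R)
    (L1 : set 'rV[R]_n -> R) (x01 : 'rV[R]_n) (eps D d : R),
    standing_assumption f ->
    lipschitz_constants f L1 ->
    0 < eps -> 0 < D -> 0 <= d ->
    Num.sqrt eps <= d ->
    Num.sqrt eps / 2 + 2 * d <= D ->
    let Delta := f x01 - inf (range f) in
    let RT := 4 * Delta / Num.sqrt eps + D in
    let T := `|Num.ceil (4 * Delta / (Num.sqrt eps * D) + 1)|%N in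
    exists (tr : seq (slo_state R n)) (out : slo_state R n),
      [/\ slo_run f L1 eps D d (slo_init x01) tr out,
          (slo_epoch out <= T)%N,
          enorm (grad f (slo_point out)) ^+ 2 <= eps
        & (\sum_(1 <= tau < T.+1) last_index tr tau)%:R
            <= c%:R * (Delta / eps * L1 (eball x01 RT))].
Proof.
exists 2%N => R n f L1 x01 eps D d fP L1P eps0 D0 _ sd sdD Delta RT T.
have s0 : 0 < Num.sqrt eps by rewrite sqrtr_gt0.
have init := slo_inv_init f x01 eps0 sd sdD.
have w0 s (_ : slo_inv f x01 eps D s) := remaining_work_ge0 x01 D fP L1P eps0 s.
have stepP := slo_step_inv (x01 := x01) fP L1P eps0 sd sdD.
have [tr [out [r Io oN]]] := slo_run_exists w0 stepP init.
exists tr, out; split=> //.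
- have arg_le : (slo_epoch out)%:R <= 4 * Delta / (Num.sqrt eps * D) + 1.
    case: out Io {r oN} => tau k x0 x /= [_ _ _ _ tauP].
    rewrite -lerBlDr ler_pdivlMr ?mulr_gt0//.
    have : inf (range f) <= f x0.
      by case: fP => _ lb _ _; apply: ge_inf lb _ _; exists x0.
    rewrite /Delta; lra.
  have := le_trans arg_le (ceil_ge _).
  rewrite -/T -[X in X <= _]/((slo_epoch out)%:~R) ler_int => le_ceil.
  by rewrite -lez_nat /T gez0_abs// (le_trans _ le_ceil).
- case: out oN {r Io} => tau k x0 x /=; case: ifP => // _.
  case: ifP => // /ltW gs _.
  by rewrite -[leRHS](sqr_sqrtr (ltW eps0)) lerXn2r// nnegrE ?enorm_ge0// ltW.
- have := sum_last_index_le w0 stepP T.+1 r init.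
  rewrite /= add0r => /le_trans; apply; rewrite /remaining_work/= -/Delta -/RT.
  by rewrite le_eqVlt; apply/predU1P; left; ring.
Qed.
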